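(* Let $X$ be a real Hilbert space, let $A,B\colon X\rightrightarrows X$ be maximally $\alpha$-monotone and maximally $\beta$-monotone, respectively, with $\alpha+\beta=0$, and let $C\colon X\to X$ be $\sigma$-cocoercive. Let $\eta>0$ and let $\gamma>0$ satisfy $$1+2\gamma\alpha>0\quad\text{and}\quad \eta^*:=2+2\gamma\alpha-\frac{\gamma}{2\sigma}>0.$$ Set $\delta:=\frac{\gamma}{1+2\gamma\alpha}$, $\lambda:=1+\frac\delta\gamma$, $S:=(1-\lambda)\mathrm{Id}+\lambda J_{\gamma A}-\delta CJ_{\gamma A}$, and $T_{A,B,C}:=\mathrm{Id}-\eta J_{\gamma A}+\eta J_{\delta B}S$. Let $x_0\in X$ and $x_{n+1}:=T_{A,B,C}x_n$. Then: (i) $T_{A,B,C}$ is single-valued and has full domain. (ii) For all $x,y\in X$, writing $T=T_{A,B,C}$, $$\|Tx-Ty\|^2\le\|x-y\|^2-\Big(\frac{\eta^*}{\eta}-1\Big)\|(\mathrm{Id}-T)x-(\mathrm{Id}-T)y\|^2-\frac{\gamma}{2\eta\sigma}\|(\mathrm{Id}-T)x-(\mathrm{Id}-T)y-2\eta\sigma(CJ_{\gamma A}x-CJ_{\gamma A}y)\|^2.$$ In particular, $T_{A,B,C}$ is conically $\frac{\eta}{\eta^*}$-averaged. (iii) If $\operatorname{zer}(A+B+C)\neq\varnothing$ and $\eta<\eta^*$, then $\|x_n-T_{A,B,C}x_n\|=o(1/\sqrt n)$, $(x_n)$ converges weakly to some $x^*\in\operatorname{Fix}T_{A,B,C}$,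 $(J_{\gamma A}x_n)$ and $(J_{\delta B}Sx_n)$ converge weakly to $J_{\gamma A}x^*=J_{\delta B}Sx^*\in\operatorname{zer}(A+B+C)$, $(CJ_{\gamma A}x_n)$ converges strongly to $CJ_{\gamma A}x^*$, and $C(\operatorname{zer}(A+B+C))=\{CJ_{\gamma A}x^*\}$.
   Context: For $A\colon X\rightrightarrows X$, $J_A:=(\mathrm{Id}+A)^{-1}$ is the resolvent, $\operatorname{zer}A:=\{x:0\in Ax\}$. $A$ is $\alpha$-monotone ($\alpha\in\mathbb R$) if $\langle x-y,u-v\rangle\ge\alpha\|x-y\|^2$ for all $(x,u),(y,v)\in\operatorname{gra}A$; it is maximally $\alpha$-monotone if it is $\alpha$-monotone and no $\alpha$-monotone operator has a graph properly containing $\operatorname{gra}A$. $C$ is $\sigma$-cocoercive ($\sigma>0$) if $\langle x-y,Cx-Cy\rangle\ge\sigma\|Cx-Cy\|^2$ for all $x,y$. $T$ is conically $\theta$-averaged ($\theta>0$) if $T=(1-\theta)\mathrm{Id}+\theta N$ for some nonexpansive $N$. $\operatorname{Fix}T=\{x:Tx=x\}$. *)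

(* Defs.v *)
From HB Require Import structures.
From mathcomp Require Import all_boot all_order all_algebra.
From mathcomp Require Import all_classical all_reals all_analysis.
Set Implicit Arguments. Unset Strict Implicit. Unset Printing Implicit Defensive.
Import Order.TTheory GRing.Theory Num.Theory.
Import numFieldNormedType.Exports.
Local Open Scope classical_set_scope.
Local Open Scope ring_scope.

Section Defs.
Variables (R : realType) (X : normedModType R).

(* A real Hilbert space: a complete normed space whose norm is induced by an
   inner product [ip] (completeness is imposed by taking X a
   completeNormedModType in the theorem). *)
Definition inner_product (ip : X -> X -> R) : Prop :=
  [/\ (forall x y, ip x y = ip y x),
      (forall (a : R) x y z, ip (a *: x + y) z = a * ip x z + ip y z) &
      (forall x, ip x x = `|x| ^+ 2)].

Definition op := X -> set X.

Definition opId : op := fun x => [set x].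
Definition opfun (f : X -> X) : op := fun x => [set f x].
Definition opadd (A B : op) : op :=
  fun x => [set w | exists u v, A x u /\ B x v /\ w = u + v].
Definition opopp (A : op) : op := fun x => [set w | exists u, A x u /\ w = - u].
Definition opsub (A B : op) : op := opadd A (opopp B).
Definition opscale (g : R) (A : op) : op :=
  fun x => [set w | exists u, A x u /\ w = g *: u].
Definition opcomp (A B : op) : op :=
  fun x => [set w | exists y, B x y /\ A y w].
Definition opinv (A : op) : op := fun x => [set y | A y x].
Definition resolvent (A : op) : op := opinv (opadd opId A).

Definition zer (A : op) : set X := [set x | A x 0].
Definition Fix (T : op) : set X := [set x | T x x].

Definition single_valued_full_domain (T : op) : Prop :=
  forall x, exists! y, T x y.

Definition alpha_monotone (ip : X -> X -> R) (alpha : R) (A : op) : Prop :=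
  forall x y u v, A x u -> A y v -> alpha * `|x - y| ^+ 2 <= ip (x - y) (u - v).

Definition max_alpha_monotone (ip : X -> X -> R) (alpha : R) (A : op) : Prop :=
  alpha_monotone ip alpha A /\
  forall A' : op, alpha_monotone ip alpha A' ->
    (forall x u, A x u -> A' x u) -> (forall x u, A' x u -> A x u).

Definition cocoercive (ip : X -> X -> R) (sigma : R) (C : X -> X) : Prop :=
  0 < sigma /\ forall x y, sigma * `|C x - C y| ^+ 2 <= ip (x - y) (C x - C y).

Definition nonexpansive (N : X -> X) : Prop :=
  forall x y, `|N x - N y| <= `|x - y|.

Definition conically_averaged (theta : R) (T : op) : Prop :=
  0 < theta /\ exists N : X -> X, nonexpansive N /\
    forall x, T x = [set (1 - theta) *: x + theta *: N x].

Definition weak_cvg (ip : X -> X -> R) (u : nat -> X) (p : X) : Prop :=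
  forall z, ip (u n) z @[n --> \oo] --> ip p z.

End Defs.

(* Main.v *)
(* Minty's theorem and the Riesz representation theorem are both obtained by
   maximizing a strongly concave function: maximizing sequences are Cauchy, so
   no weak compactness is needed. For Minty, the function is the concave dual of
   the problem of finding a point monotonically related to a given graph.

   Adding the monotonicity inequalities of [A] and [B] at the points produced by
   one step makes the quadratic terms in the resolvents cancel, since
   [alpha + beta = 0]; completing the square with the cocoercivity of [C] gives
   the estimate (ii), hence Fejer monotonicity and the rate.

   Weak limits are taken along ultrafilters on the indices (no separability or
   subsequences): bounded sequences have a weak limit along each of them by Riesz,
   Opial's argument shows that for the iterates they all agree, and a Fitzpatrick-style
   test of the summed inequalities identifies the weak limit of the shadows. *)

Require Import Defs.
From HB Require Import structures.
From mathcomp Require Import all_boot all_order all_algebra.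
From mathcomp Require Import all_classical all_reals all_analysis.
From mathcomp Require Import ring lra zify.
Set Implicit Arguments.
Unset Strict Implicit.
Unset Printing Implicit Defensive.
Import Order.TTheory GRing.Theory Num.Theory.
Import numFieldNormedType.Exports.
Local Open Scope classical_set_scope.
Local Open Scope ring_scope.

(** * Inner products, Riesz representation *)

(** Closes first-order perturbation arguments: [t] is the size of the perturbation, kept at most 1
    so that higher-order errors fit into [K]. *)
Lemma le0_of_linear_bound (R : realType) (d K : R) :
  (forall t, 0 < t -> t <= 1 -> d <= t * K) -> d <= 0.
Proof.
move=> h; rewrite leNgt; apply/negP => d0.
have K0 : 0 < K by apply: lt_le_trans d0 _; have := h 1 ltr01 (lexx _); rewrite mul1r.
(* At this [t] the bound becomes [d + 2 * K <= K], absurd for positive [d] and [K]. *)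
have t0 : 0 < d / (d + K *+ 2) by rewrite divr_gt0 // addr_gt0 // mulrn_wgt0.
have := h _ t0; rewrite ler_pdivrMr ?mul1r; last lra.
move=> /(_ ltac:(lra)).
rewrite mulrAC ler_pdivlMr; last lra.
by nra.
Qed.

Section InnerProduct.
Variables (R : realType) (X : normedModType R) (ip : X -> X -> R).
Hypothesis ip_inner : inner_product ip.

Lemma ipC x y : ip x y = ip y x. Proof. by case: ip_inner. Qed.

Lemma ip_norm x : ip x x = `|x| ^+ 2. Proof. by case: ip_inner. Qed.

Lemma ipDl x y z : ip (x + y) z = ip x z + ip y z.
Proof. by case: ip_inner => _ h _; rewrite -{1}(scale1r x) h mul1r. Qed.

Lemma ip0l z : ip 0 z = 0.
Proof. by apply: (addrI (ip 0 z)); rewrite -ipDl !addr0. Qed.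

Lemma ipZl a x z : ip (a *: x) z = a * ip x z.
Proof. by case: ip_inner => _ h _; rewrite -{1}(addr0 (a *: x)) h ip0l addr0. Qed.

Lemma ipNl x z : ip (- x) z = - ip x z.
Proof. by rewrite -scaleN1r ipZl mulN1r. Qed.

Lemma ipDr x y z : ip z (x + y) = ip z x + ip z y.
Proof. by rewrite ipC ipDl !(ipC z). Qed.

Lemma ipZr a x z : ip z (a *: x) = a * ip z x.
Proof. by rewrite ipC ipZl (ipC z). Qed.

Lemma ipNr x z : ip z (- x) = - ip z x.
Proof. by rewrite ipC ipNl (ipC z). Qed.

Definition ipE := (ipDl, ipDr, ipNl, ipNr, ipZl, ipZr).

Lemma ip_ge0 x : 0 <= ip x x. Proof. by rewrite ip_norm exprn_ge0. Qed.

Lemma ip_le_norm x y : `|ip x y| <= `|x| * `|y|.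
Proof.
rewrite -ler_sqr ?nnegrE ?mulr_ge0// real_normK ?num_real// exprMn -!ip_norm.
have [->|y0] := eqVneq y 0; first by rewrite (ipC x) !ip0l expr0n mulr0.
have yy : 0 < ip y y by rewrite ip_norm exprn_gt0 ?normr_gt0.
have := ip_ge0 (ip y y *: x - ip x y *: y).
rewrite !ipE (ipC y x) => h.
have : 0 <= ip y y * (ip x x * ip y y - ip x y ^+ 2) by lra.
by rewrite pmulr_rge0// subr_ge0.
Qed.

End InnerProduct.

Section Hilbert.
Variables (R : realType) (X : completeNormedModType R) (ip : X -> X -> R).
Hypothesis ip_inner : inner_product ip.
Let ipE := (ipE ip_inner).
Let ipC := (ipC ip_inner).
Let ip_norm := (ip_norm ip_inner).

(* Maximizing sequences of a strongly concave function are Cauchy; the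
   function is given by its graph [P], which may be multivalued. *)
Lemma strongly_concave_sup (P : X -> R -> Prop) (M : R) :
  (exists x d, P x d) -> (forall x d, P x d -> d <= M) ->
  (forall x d y e, P x d -> P y e ->
     exists z f, P z f /\ (d + e) / 2 + `|x - y| ^+ 2 / 4 <= f) ->
  exists x m, (forall y e, P y e -> e <= m) /\ m <= M /\
    forall eps, 0 < eps -> exists y e, P y e /\ `|x - y| < eps /\ m - eps < e.
Proof.
move=> [x0 [d0 Pxd]] PM Pmid.
pose E := [set d | exists x, P x d].
have Esup : has_sup E.
  by split; [exists d0, x0|exists M => d [x] /PM].
pose m := sup E.
have mP y e : P y e -> e <= m by move=> Pye; apply: ub_le_sup; [case: Esup|exists y].
have /choice[u uP] n : exists q : X * R, P q.1 q.2 /\ m - n.+1%:R^-1 < q.2.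
  have n0 : 0 < n.+1%:R^-1 :> R by rewrite invr_gt0.
  by have [d [y Pyd] ?] := sup_adherent n0 Esup; exists (y, d).
(* Both values are within [1 / (N + 1)] of [m], and the value at the point supplied by [Pmid] is at
   most [m]. *)
have key n N : (N <= n)%N -> `|(u N).1 - (u n).1| ^+ 2 <= 4 * N.+1%:R^-1.
  move=> Nn; have [PN uN] := uP N; have [Pn un] := uP n.
  have [z [f [/mP fm]]] := Pmid _ _ _ _ PN Pn.
  have : (n.+1%:R^-1 : R) <= N.+1%:R^-1 by rewrite lef_pV2 ?posrE// ler_nat.
  by move: un uN; set a := n.+1%:R^-1; set b := N.+1%:R^-1; lra.
have key2 e : 0 < e -> exists N, forall n, (N <= n)%N -> `|(u N).1 - (u n).1| < e.
  move=> e0; have e40 : 0 < e ^+ 2 / 4 by rewrite divr_gt0 ?exprn_gt0.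
  have [N _ NP] := near_infty_natSinv_lt (PosNum e40).
  exists N => n Nn.
  rewrite -ltr_sqr ?nnegrE ?(ltW e0)//; apply: le_lt_trans (key _ _ Nn) _.
  by have /= := NP _ (leqnn N); rewrite ltr_pdivlMr// mulrC.
have : cauchy ((fun n => (u n).1) @ \oo).
  apply: cauchy_exP => e e0; have [N NP] := key2 _ e0.
  by exists (u N).1, N => // n /= Nn; rewrite -ball_normE /=; exact: NP.
move=> /cauchy_cvg/cvg_ex[/= x ux]; exists x, m; split; first exact: mP.
split; first by apply: ge_sup; [exists d0, x0|move=> d [y] /PM].
move=> eps eps0.
have /cvgrPdist_lt/(_ _ eps0)[N1 _ N1P] := ux.
have [N2 _ N2P] := near_infty_natSinv_lt (PosNum eps0).
have [Pn un] := uP (N1 + N2)%N.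
exists (u (N1 + N2)%N).1, (u (N1 + N2)%N).2; split => //; split.
  by apply: N1P; rewrite /= leq_addr.
by apply: lt_trans un; rewrite ltrD2l ltrN2; exact: (N2P (N1 + N2)%N (leq_addl _ _)).
Qed.

(** The representer is the maximizer of [2 * f x - ip x x], which for [f = ip p] equals
    [|p|^2 - |x - p|^2]. *)
Lemma riesz (f : X -> R) (M : R) :
  (forall a x y, f (a *: x + y) = a * f x + f y) ->
  (forall x, `|f x| <= M * `|x|) -> exists p, forall z, f z = ip p z.
Proof.
move=> fl fM.
have f0 : f 0 = 0 by have := fM 0; rewrite normr0 mulr0 normr_le0 => /eqP.
have fZ a x : f (a *: x) = a * f x by rewrite -[a *: x]addr0 fl f0 addr0.
have fD x y : f (x + y) = f x + f y by rewrite -{1}[x]scale1r fl mul1r.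
have fN x : f (- x) = - f x by rewrite -scaleN1r fZ mulN1r.
pose D x := 2 * f x - ip x x.
have fle x : f x <= M * `|x| by apply: le_trans (ler_norm _) (fM x).
have [||x d y e -> ->|p [m [pm [_ pa]]]] :=
    @strongly_concave_sup (fun x d => d = D x) (M ^+ 2).
- by exists 0, (D 0).
- move=> x _ ->; rewrite /D ip_norm; have := fle x; have := sqr_ge0 (`|x| - M).
  by rewrite sqrrB; lra.
- exists (2^-1 *: (x + y)), (D (2^-1 *: (x + y))); split=> //.
  by rewrite /D -ip_norm !ipE !fZ !fD (ipC y x); lra.
(* Only approximate maximizers near [p] are given; quantitative continuity of [D] shows that [p]
   attains the supremum. *)
have Dp : m <= D p.
  rewrite -subr_le0.
  apply: (@le0_of_linear_bound _ _ (1 + 2 * `|M| + 2 * `|p| + 1)) => t t0 t1.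
  have [y [_ [-> [pyt yt]]]] := pa _ t0.
  have -> : m - D p = m - t - D y + t + 2 * f (y - p) + (ip p p - ip y y).
    by rewrite /D fD fN; lra.
  have h1 : f (y - p) <= t * `|M|.
    apply: le_trans (fle _) _; rewrite mulrC distrC.
    by apply: le_trans (_ : _ <= `|p - y| * `|M|) _;
      [rewrite ler_wpM2l// ler_norm|rewrite ler_wpM2r// ltW].
  have h2 : ip p p - ip y y <= t * (2 * `|p| + 1).
    rewrite !ip_norm subr_sqr.
    have a1 : `|p| - `|y| <= t by apply: le_trans (ltW pyt); exact: lerB_dist.
    have a2 : `|y| <= `|p| + t.
      by rewrite -lerBlDl; apply: le_trans (ltW pyt); rewrite distrC; exact: lerB_dist.
    have := normr_ge0 p; have := normr_ge0 y.
    by have [?|/ltW ?] := leP `|y| `|p|; nra.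
  by lra.
exists p => z; apply/eqP; rewrite -subr_eq0; apply/eqP.
(* First-order optimality: [p] is compared with [p + c s z], the two signs of [c] being kept
   together through [c ^+ 2 = 1]. *)
have h s : 0 < s -> s <= 1 -> forall c : R, c ^+ 2 = 1 -> c * (2 * (f z - ip p z)) <= s * ip z z.
  move=> s0 _ c c1.
  have := le_trans (pm _ _ (erefl (D (p + (c * s) *: z)))) Dp.
  rewrite /D fD fZ !ipE (ipC z p) => hh.
  rewrite -(ler_pM2l s0).
  have -> : s * (s * ip z z) = c ^+ 2 * s ^+ 2 * ip z z by rewrite c1; ring.
  by lra.
have h1 := @le0_of_linear_bound _ _ _ (fun s s0 s1 => h s s0 s1 1 (expr1n _ _)).
have h2 := @le0_of_linear_bound _ _ _
  (fun s s0 s1 => h s s0 s1 (-1) ltac:(by rewrite sqrrN expr1n)).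
by lra.
Qed.

End Hilbert.

(** * Minty's theorem *)

(** Generated by two-point convex combinations, so that statements affine in each triple follow by
    induction. *)
Inductive graph_hull (R : realType) (X : normedModType R) (ip : X -> X -> R)
    (G : X -> X -> Prop) : X -> X -> R -> Prop :=
| graph_hull_gen y w : G y w -> graph_hull ip G y w (ip y w)
| graph_hull_conv t a b r a' b' r' : 0 <= t -> t <= 1 ->
    graph_hull ip G a b r -> graph_hull ip G a' b' r' ->
    graph_hull ip G ((1 - t) *: a + t *: a') ((1 - t) *: b + t *: b')
      ((1 - t) * r + t * r').

Section Minty.
Variables (R : realType) (X : completeNormedModType R) (ip : X -> X -> R).
Hypothesis ip_inner : inner_product ip.
Let ipE := (ipE ip_inner).
Let ipC := (ipC ip_inner).
Let ip_norm := (ip_norm ip_inner).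

(** The inequality is affine in each triple separately, so two inductions reduce it to generators,
    where it is monotonicity expanded. *)
Lemma graph_hull_monotone (G : X -> X -> Prop) :
  (forall y w y' w', G y w -> G y' w' -> 0 <= ip (y - y') (w - w')) ->
  forall a b r a' b' r', graph_hull ip G a b r -> graph_hull ip G a' b' r' ->
    ip a b' + ip a' b <= r + r'.
Proof.
move=> Gm a b r a' b' r' h1 h2; elim: h1 => {a b r}
  [y w Gyw|t a b r c d s t0 t1 _ IH1 _ IH2]; last first.
  by rewrite !ipE; nra.
elim: h2 => {a' b' r'} [y' w' Gyw'|t a b r c d s t0 t1 _ IH1 _ IH2]; last first.
  by rewrite !ipE; nra.
by have := Gm _ _ _ _ Gyw Gyw'; rewrite !ipE; lra.
Qed.

(* The dual of the problem of minimizing over [x] the supremum over [G] of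
   [ip (x - y) (x + w)]: on the convex hull of the triples [(y, w, ip y w)] the
   dual function [(a, b, r) |-> - r - |(a - b) / 2|^2] is strongly concave in
   [(a - b) / 2], and it is nonpositive by monotonicity. *)
Lemma monotone_extension (G : X -> X -> Prop) :
  (forall y w y' w', G y w -> G y' w' -> 0 <= ip (y - y') (w - w')) ->
  exists x, forall y w, G y w -> 0 <= ip (x - y) (- x - w).
Proof.
move=> Gm.
have [[y0 [w0 Gyw0]]|G0] := pselect (exists y w, G y w); last first.
  by exists 0 => y w Gyw; case: G0; exists y, w.
pose P c d := exists a b r, [/\ graph_hull ip G a b r, c = 2^-1 *: (a - b) &
  d = - r - ip c c].
have Pgen y w : G y w -> P (2^-1 *: (y - w)) (- (ip (y + w) (y + w)) / 4).
  move=> Gyw; exists y, w, (ip y w); split=> //; first exact: graph_hull_gen.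
  by rewrite !ipE (ipC w y); lra.
(* Only [- ip c c] is not affine in the triple, whence the exact quadratic gain. *)
have Pconv t c d c' d' : 0 <= t -> t <= 1 -> P c d -> P c' d' ->
    P ((1 - t) *: c + t *: c')
      ((1 - t) * d + t * d' + t * (1 - t) * ip (c - c') (c - c')).
  move=> t0 t1 [a [b [r [h -> ->]]]] [a' [b' [r' [h' -> ->]]]].
  exists ((1 - t) *: a + t *: a'), ((1 - t) *: b + t *: b'), ((1 - t) * r + t * r').
  split; first exact: graph_hull_conv.
    rewrite opprD !(scalerDr, scalerN) !scalerA addrACA.
    by rewrite (mulrC _ (1 - t)) (mulrC _ t).
  rewrite !ipE (ipC a' a) (ipC b' b) (ipC b a) (ipC b' a') (ipC b' a) (ipC a' b).
  by field.
have [||c d c' d' h h'|x [m [mP [m0 xP]]]] := @strongly_concave_sup _ _ P 0.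
- by exists (2^-1 *: (y0 - w0)), (- (ip (y0 + w0) (y0 + w0)) / 4); exact: Pgen.
- move=> _ _ [a [b [r [h -> ->]]]].
  (* Pairing a triple with itself gives [ip a b <= r], so the dual value is at most
     [- |a + b|^2 / 4]. *)
  have := graph_hull_monotone Gm h h.
  have := ip_ge0 ip_inner (a + b).
  by rewrite !ipE (ipC b a); lra.
- have t0 : 0 <= 2^-1 :> R by rewrite invr_ge0.
  have t1 : 2^-1 <= 1 :> R by lra.
  exists ((1 - 2^-1) *: c + 2^-1 *: c'), ((1 - 2^-1) * d + 2^-1 * d' +
    2^-1 * (1 - 2^-1) * ip (c - c') (c - c')); split; first exact: Pconv.
  by rewrite ip_norm; lra.
exists x => y w Gyw.
set c := 2^-1 *: (y - w); set D := - (ip (y + w) (y + w)) / 4.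
(* Expanded, the goal reads [|x - c|^2 + D <= 0], and [m <= 0]. *)
suff : `|x - c| ^+ 2 + D - m <= 0.
  rewrite -ip_norm /D /c !ipE (ipC w y) (ipC w x) (ipC y x); lra.
set K := `|x - c|; have K0 : 0 <= K by exact: normr_ge0.
apply: (@le0_of_linear_bound _ _ (K ^+ 2 + 2 * K + 1)) => t t0 t1.
(* A near-maximizer is moved by [t] towards [c]. The tolerance [t ^+ 2] leaves an error of order [t]
   after division by [t]. *)
have [z [e [Pz [xz me]]]] := xP (t ^+ 2) (exprn_gt0 _ t0).
have := mP _ _ (Pconv t _ _ _ _ (ltW t0) t1 Pz (Pgen _ _ Gyw)).
rewrite -/c -/D ip_norm.
have Kz : K - t ^+ 2 <= `|z - c|.
  rewrite lerBlDl; apply: le_trans (ler_distD z _ _) _.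
  by rewrite lerD2r ltW.
have zc : K ^+ 2 - 2 * t ^+ 2 * K <= `|z - c| ^+ 2.
  have [?|?] := leP K (t ^+ 2); first by have := sqr_ge0 `|z - c|; nra.
  have : (K - t ^+ 2) ^+ 2 <= `|z - c| ^+ 2 by rewrite ler_sqr ?nnegrE// subr_ge0 ltW.
  by have := sqr_ge0 (t ^+ 2); rewrite sqrrB; lra.
move=> hm.
have h1 : (1 - t) * (m - t ^+ 2) <= (1 - t) * e by rewrite ler_wpM2l ?subr_ge0// ltW.
have h2 : t * (1 - t) * (K ^+ 2 - 2 * t ^+ 2 * K) <= t * (1 - t) * `|z - c| ^+ 2.
  by rewrite ler_wpM2l// mulr_ge0 ?subr_ge0// ltW.
rewrite -(ler_pM2l t0).
have h3 : t ^+ 2 * (1 - t) <= t ^+ 2 by rewrite ler_piMr ?sqr_ge0//; lra.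
have h4 : t * (1 - t) * (2 * t ^+ 2 * K) <= 2 * t ^+ 2 * K.
  rewrite [leLHS](_ : _ = (2 * t ^+ 2 * K) * (t * (1 - t))); last by ring.
  by rewrite ler_piMr ?mulr_ge0 ?sqr_ge0 //; nra.
lra.
Qed.

(** The hypothesis allows [(x, u)] to be adjoined to the graph without losing [a]-monotonicity, so
    maximality already puts it there. *)
Lemma max_alpha_monotone_mem (a : R) (A : op X) x u : max_alpha_monotone ip a A ->
  (forall y v, A y v -> a * `|x - y| ^+ 2 <= ip (x - y) (u - v)) -> A x u.
Proof.
move=> [Am Amax] h.
apply: (Amax (fun y v => A y v \/ y = x /\ v = u)) => //; last by right.
- move=> y y' v v' [Ay|[-> ->]] [Ay'|[-> ->]].
  + exact: Am.
  + have := h _ _ Ay; rewrite distrC => /le_trans; apply.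
    by rewrite !ipE; lra.
  + exact: h.
  + by rewrite !subrr (ip0l ip_inner) normr0 expr0n mulr0.
- by move=> y v; left.
Qed.

Lemma max_alpha_monotone_surj (a g : R) (A : op X) : max_alpha_monotone ip a A ->
  0 < g -> 0 < 1 + g * a -> forall z, exists x, A x (g^-1 *: (z - x)).
Proof.
move=> Amm g0 k0 z; set k := 1 + g * a in k0.
(* Since [v - a y] is monotone along the graph, so is [G]. The shift by [z] and the scaling by [k]
   turn the test [0 <= ip (x - y) (- x - w)] into [a |x - y|^2 <= ip (x - y) ((z - x) / g - v)]. *)
pose G y w := exists2 v, A y v & w = k^-1 *: (g *: v - (g * a) *: y - z).
have [|x xP] := @monotone_extension G.
  move=> y _ y' _ [v Av ->] [v' Av' ->].
  have := (Amm.1 _ _ _ _ Av Av'); rewrite -ip_norm.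
  set i := ip _ _ => h.
  rewrite [leRHS](_ : _ = k^-1 * (g * (ip (y - y') (v - v') - a * ip (y - y') (y - y')))).
    by rewrite mulr_ge0 ?invr_ge0 ?(ltW k0)// mulr_ge0 ?(ltW g0)// subr_ge0.
  by rewrite !ipE; ring.
exists x; apply: (max_alpha_monotone_mem Amm) => y v Av.
have := xP _ _ (ex_intro2 _ _ v Av erefl).
rewrite -(pmulr_rge0 _ k0) -(pmulr_rge0 _ (_ : 0 < g^-1)) ?invr_gt0//.
rewrite -[in X in _ -> X]subr_ge0 => /le_trans; apply; rewrite -ip_norm !ipE (ipC y x) /k.
rewrite le_eqVlt; apply/orP; left; apply/eqP; field.
by rewrite (gt_eqF k0) gt_eqF.
Qed.

Lemma resolvent_unique (a g : R) (A : op X) : alpha_monotone ip a A ->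
  0 < g -> 0 < 1 + g * a -> forall z x x', A x (g^-1 *: (z - x)) ->
  A x' (g^-1 *: (z - x')) -> x = x'.
Proof.
move=> Am g0 k0 z x x' Ax Ax'; have := Am _ _ _ _ Ax Ax'.
rewrite -scalerBr (_ : z - x - (z - x') = - (x - x')); last first.
  by rewrite !opprB addrC subrKA.
rewrite (ipZr ip_inner) (ipNr ip_inner) ip_norm => h.
apply/subr0_eq/eqP; rewrite -normr_eq0 -sqrf_eq0 eq_le sqr_ge0 andbT.
rewrite -(pmulr_rle0 _ k0).
have : g * (a * `|x - x'| ^+ 2) <= - `|x - x'| ^+ 2.
  by rewrite -ler_pdivlMl.
by lra.
Qed.

End Minty.

(** * Weak limits along ultrafilters *)

Section UltraLimits.

(** Compactness of [[-M, M]] gives a cluster point, and an ultrafilter converges to each of its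
    cluster points. *)
Lemma ultra_bounded_cvg (R : realType) (T : Type) (U : set_system T) (f : T -> R)
    (M : R) :
  UltraFilter U -> (forall t, `|f t| <= M) -> exists l : R, f t @[t --> U] --> l.
Proof.
move=> UU fM.
have [|l [_ lcl]] := @segment_compact R (- M) M (f @ U).
  by apply: (@filterE _ U) => t; rewrite /= in_itv /= -ler_norml.
exists l => V lV.
have [//|UV] := in_ultra_setVsetC (f @^-1` V) UU.
by have [x [/= nVx Vx]] := lcl (~` V) V UV lV.
Qed.

(** If the preimage of a neighbourhood were not in [F], an ultrafilter refining [F] and containing
    its complement would contradict the hypothesis. *)
Lemma cvg_ultra (T : Type) (Y : topologicalType) (F : set_system T) (f : T -> Y) (l : Y) :
  Filter F ->
  (forall U, UltraFilter U -> F `<=` U -> f t @[t --> U] --> l) ->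
  f t @[t --> F] --> l.
Proof.
move=> FF h V lV; apply: contrapT => nFV.
pose W := ~` (f @^-1` V).
have WF : ProperFilter (within W F).
  split; last exact: within_filter.
  rewrite /within /= => FW; apply: nFV; apply: filterS FW => t /=.
  by move=> Wt; apply: contrapT => /Wt.
have [U [UU WU]] := ultraFilterLemma WF.
have UV : U (f @^-1` V).
  by apply: h => //; apply: subset_trans WU; exact: cvg_within.
have UW : U W by apply: WU; exact: withinT.
have := filterI UV UW; rewrite setICr => U0.
exact: (@filter_not_empty _ U _ (U0 _)).
Qed.

End UltraLimits.

Section WeakLimits.
Variables (R : realType) (X : completeNormedModType R) (ip : X -> X -> R).
Hypothesis ip_inner : inner_product ip.
Let ipE := (ipE ip_inner).
Let ipC := (ipC ip_inner).
Let ip_norm := (ip_norm ip_inner).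

Definition weakly (F : set_system nat) (u : nat -> X) (p : X) : Prop :=
  forall z, ip (u n) z @[n --> F] --> ip p z.

(** The limit of [ip (u n) z] along [U] is linear in [z] and bounded by [M |z|], so Riesz
    applies. *)
Lemma ultra_weakly_bounded U (u : nat -> X) (M : R) : UltraFilter U ->
  (forall n, `|u n| <= M) -> exists p, weakly U u p.
Proof.
move=> UU uM.
have uzM z n : `|ip (u n) z| <= M * `|z|.
  by apply: le_trans (ip_le_norm ip_inner _ _) _; rewrite ler_wpM2r.
have /choice[f fP] z := ultra_bounded_cvg UU (uzM z).
have [a x y|x|p pf] := @riesz _ _ ip ip_inner f M.
- have h : ip (u n) (a *: x + y) @[n --> U] --> a * f x + f y.
    under eq_fun do rewrite (ipDr ip_inner) (ipZr ip_inner).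
    by apply: cvgD; [apply: cvgMr|]; exact: fP.
  exact: (cvg_unique _ (fP _) h).
- apply: (cvgr_to_le (cvg_norm (fP x))).
  by apply: filterE => n; exact: uzM.
by exists p => z; rewrite -pf.
Qed.

Lemma bounded_weak_cvg (u : nat -> X) (M : R) q : (forall n, `|u n| <= M) ->
  (forall U p, UltraFilter U -> \oo `<=` U -> weakly U u p -> p = q) ->
  weak_cvg ip u q.
Proof.
move=> uM uq z; apply: cvg_ultra => U UU ooU.
have [p up] := ultra_weakly_bounded UU uM.
by rewrite -(uq U p UU ooU up).
Qed.

(* Opial's lemma: [|u n - p|^2 - |u n - q|^2] is affine in [u n], so comparing
   its limits along two ultrafilters identifies their weak limits. *)
Lemma opial (S : set X) (u : nat -> X) (M : R) : (forall n, `|u n| <= M) ->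
  (forall p, S p -> cvgn (fun n => `|u n - p| ^+ 2)) ->
  (forall U p, UltraFilter U -> \oo `<=` U -> weakly U u p -> S p) ->
  exists2 q, S q & weak_cvg ip u q.
Proof.
move=> uM uS uU.
have [U0 [U0U ooU0]] := @ultraFilterLemma nat \oo _.
have [q uq] := ultra_weakly_bounded U0U uM.
have Sq := uU _ _ U0U ooU0 uq.
exists q => //; apply: (bounded_weak_cvg uM) => U p UU ooU up.
have Sp := uU _ _ UU ooU up.
(* Read along the two ultrafilters, the limit of [ip (u n) (p - q)] is both [ip p (p - q)] and
   [ip q (p - q)]. *)
have /cvg_ex[/= l hl] : cvgn (fun n => ip (u n) (p - q)).
  rewrite (_ : (fun n => _) = fun n => 2^-1 * (`|u n - q| ^+ 2 - `|u n - p| ^+ 2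
    + (ip p p - ip q q))).
    apply: is_cvgMr; apply: is_cvgD; last exact: is_cvg_cst.
    by apply: is_cvgB; apply: uS.
  apply/funext => n; rewrite -!ip_norm !ipE (ipC q (u n)) (ipC p (u n)).
  by field.
have pl : ip p (p - q) = l.
  by apply: (cvg_unique _ (up (p - q))) => //; apply: cvg_trans hl; exact: cvg_app.
have ql : ip q (p - q) = l.
  by apply: (cvg_unique _ (uq (p - q))) => //; apply: cvg_trans hl; exact: cvg_app.
apply/subr0_eq/eqP; rewrite -normr_eq0 -sqrf_eq0 -ip_norm.
by rewrite {1}(ipDl ip_inner) (ipNl ip_inner) pl ql subrr.
Qed.

(** Expand [|u n - T p|^2] around [p]: the cross term vanishes in the weak limit, while
    nonexpansiveness bounds [|u n - T p|] by [|u n - p|] plus the residual. Subtracting leaves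
    [|p - T p|^2 <= w n], and [w] tends to 0. *)
Lemma demiclosed (T : X -> X) F (u : nat -> X) (M : R) p : ProperFilter F ->
  nonexpansive T -> (forall n, `|u n| <= M) -> weakly F u p ->
  `|u n - T (u n)| @[n --> F] --> (0 : R) -> T p = p.
Proof.
move=> FF Tn uM up uT.
pose w n := `|u n - T (u n)| ^+ 2 + 2 * (M + `|p|) * `|u n - T (u n)|
  - 2 * (ip (u n) (p - T p) - ip p (p - T p)).
have w0 : w n @[n --> F] --> (0 : R).
  rewrite (_ : 0 = 0 ^+ 2 + 2 * (M + `|p|) * 0
    - 2 * (ip p (p - T p) - ip p (p - T p))); last first.
    by rewrite subrr expr0n !mulr0 addr0 subr0.
  apply: cvgB; last by apply: cvgMr; apply: cvgB; [exact: up|exact: cvg_cst].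
  by apply: cvgD; [apply: cvgM|apply: cvgMr].
have hw n : `|p - T p| ^+ 2 <= w n.
  have h1 : `|u n - T p| <= `|u n - T (u n)| + `|u n - p|.
    by apply: le_trans (ler_distD (T (u n)) _ _) _; rewrite lerD2l; exact: Tn.
  have h2 : `|u n - p| <= M + `|p|.
    by apply: le_trans (ler_normB _ _) _; rewrite lerD2r.
  have h3 : `|u n - T p| ^+ 2 <= (`|u n - T (u n)| + `|u n - p|) ^+ 2.
    by rewrite ler_sqr ?nnegrE ?addr_ge0.
  have h4 : `|u n - T p| ^+ 2 = `|u n - p| ^+ 2 + `|p - T p| ^+ 2
      + 2 * (ip (u n) (p - T p) - ip p (p - T p)).
    rewrite -!ip_norm !ipE (ipC p (u n)) (ipC (T p) (u n)) (ipC (T p) p).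
    by ring.
  have h5 : `|u n - T (u n)| * `|u n - p| <= `|u n - T (u n)| * (M + `|p|).
    by rewrite ler_wpM2l.
  rewrite /w; move: h3; rewrite h4 sqrrD; lra.
have : `|p - T p| ^+ 2 <= 0.
  apply: (@ler_cvg_to _ F _ _ (fun=> `|p - T p| ^+ 2) w) => //.
  - exact: cvg_cst.
  - by apply: filterE => n; exact: hw.
move=> h; have : `|p - T p| ^+ 2 == 0 by rewrite eq_le h sqr_ge0.
by rewrite sqrf_eq0 normr_eq0 subr_eq0 => /eqP.
Qed.

End WeakLimits.

(** * Real sequences with summable decrease *)

Section RealSequences.
Variable R : realType.

(** As [a] is nonincreasing, [k] times its last term is at most the drop of [r] over [k] steps, and
    the tail drops vanish. *)
Lemma cvg_natM_of_descent (a r : nat -> R) : (forall n, 0 <= a n) -> (forall n, 0 <= r n) ->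
  (forall n, a n.+1 <= a n) -> (forall n, r n.+1 <= r n - a n) ->
  n%:R * a n @[n --> \oo] --> (0 : R).
Proof.
move=> a0 r0 a_dec ra.
have r_dec : nonincreasing_seq r.
  apply/nonincreasing_seqP => n; apply: le_trans (ra n) _.
  by rewrite gerBl.
have r_cvg : cvgn r.
  by apply: nonincreasing_is_cvgn => //; exists 0 => _ [n _ <-].
have /nonincreasing_seqP a_dec' := a_dec.
have sum m k : k%:R * a (m + k)%N <= r m - r (m + k)%N.
  elim: k => [|k IH]; first by rewrite addn0 mul0r subrr.
  have h1 : a (m + k.+1)%N <= a (m + k)%N by rewrite addnS.
  have h2 := ra (m + k)%N; rewrite -addnS in h2.
  have h3 : k%:R * a (m + k.+1)%N <= k%:R * a (m + k)%N by rewrite ler_wpM2l.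
  by rewrite mulrSr mulrDl mul1r; lra.
apply/cvgr0Pnorm_le => e e0.
have /cvgrPdist_le/(_ (e / 2)) := r_cvg.
rewrite divr_gt0// => /(_ isT)[N _ NP].
(* From [2N] on, [n <= 2 (n - N)]; hence the tolerance [e / 2] above. *)
exists (N + N)%N => // n /= Nn.
rewrite ger0_norm ?mulr_ge0//.
have /= := NP N (leqnn N); have := nonincreasing_cvgn_ge r_dec r_cvg => hr.
have hN := hr N; have hn := hr n.
rewrite ler0_norm ?subr_le0// => h.
have Nn' : (N <= n)%N by apply: leq_trans Nn; rewrite leq_addr.
have := sum N (n - N)%N; rewrite subnKC// => hs.
have : n%:R <= 2 * (n - N)%:R :> R.
  by rewrite -natrM ler_nat mul2n -addnn addnBA// leq_subRL ?addnA; lia.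
move=> /(ler_wpM2r (a0 n)); lra.
Qed.

Lemma cvg_of_descent (a r : nat -> R) : (forall n, 0 <= a n) -> (forall n, 0 <= r n) ->
  (forall n, r n.+1 <= r n - a n) -> a n @[n --> \oo] --> (0 : R).
Proof.
move=> a0 r0 ra.
have r_dec : nonincreasing_seq r.
  apply/nonincreasing_seqP => n; apply: le_trans (ra n) _.
  by rewrite gerBl.
have r_cvg : cvgn r.
  by apply: nonincreasing_is_cvgn => //; exists 0 => _ [n _ <-].
apply: (@squeeze_cvgr _ _ _ _ (fun=> 0) (fun n => r n - r n.+1)).
- by apply: filterE => n; rewrite a0 /= lerBrDr addrC -lerBrDr.
- exact: cvg_cst.
- have h : r n.+1 @[n --> \oo] --> limn r by rewrite (cvg_shiftS r).
  by rewrite -(subrr (limn r)); apply: cvgB.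
Qed.

End RealSequences.

(** * The three-operator iteration *)

Section BoundedSequences.
Variables (R : realType) (X : completeNormedModType R) (ip : X -> X -> R).
Hypothesis ip_inner : inner_product ip.

Definition norm_bounded (u : nat -> X) := exists M : R, forall n, `|u n| <= M.

Lemma norm_bounded_cst x : norm_bounded (fun=> x).
Proof. by exists `|x|. Qed.

Lemma norm_boundedD u v : norm_bounded u -> norm_bounded v ->
  norm_bounded (fun n => u n + v n).
Proof.
move=> [M uM] [N vN]; exists (M + N) => n.
by apply: le_trans (ler_normD _ _) _; exact: lerD.
Qed.

Lemma norm_boundedZ (a : R) u : norm_bounded u -> norm_bounded (fun n => a *: u n).
Proof. by move=> [M uM]; exists (`|a| * M) => n; rewrite normrZ ler_wpM2l. Qed.

Lemma norm_boundedN u : norm_bounded u -> norm_bounded (fun n => - u n).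
Proof. by move=> [M uM]; exists M => n; rewrite normrN. Qed.

Lemma norm_bounded_lipschitz (k : R) (f : X -> X) u : 0 < k ->
  (forall x y, k * `|f x - f y| <= `|x - y|) -> norm_bounded u ->
  norm_bounded (fun n => f (u n)).
Proof.
move=> k0 fk [M uM]; exists (k^-1 * (M + `|u 0%N|) + `|f (u 0%N)|) => n.
rewrite -{1}(subrK (f (u 0%N)) (f (u n))); apply: le_trans (ler_normD _ _) _.
rewrite lerD2r ler_pdivlMl//; apply: le_trans (fk _ _) _.
by apply: le_trans (ler_normB _ _) _; rewrite lerD2r.
Qed.

Lemma ip_bounded_cvg0 F (u v : nat -> X) : Filter F -> norm_bounded u ->
  v n @[n --> F] --> (0 : X) -> ip (u n) (v n) @[n --> F] --> (0 : R).
Proof.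
move=> FF [M uM] v0.
apply: (@norm_cvg0 _ _ _ _ _ (fun n => ip (u n) (v n))).
apply: (@squeeze_cvgr _ _ _ _ (fun=> 0) (fun n => M * `|v n|)).
- apply: filterE => n; rewrite normr_ge0/=.
  by apply: le_trans (ip_le_norm ip_inner _ _) _; rewrite ler_wpM2r.
- exact: cvg_cst.
- by rewrite -(mulr0 M); apply: cvgMr; rewrite -(normr0 X); exact: cvg_norm.
Qed.

Lemma cvg0_sqr_norm F (v : nat -> X) : Filter F ->
  `|v n| ^+ 2 @[n --> F] --> (0 : R) -> v n @[n --> F] --> (0 : X).
Proof.
move=> FF v2; apply: norm_cvg0.
have := cvg_comp _ _ v2 (@sqrt_continuous R 0); rewrite sqrtr0.
rewrite (_ : _ \o _ = fun n => `|v n|) //.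
by apply/funext => n /=; rewrite sqrtr_sqr normr_id.
Qed.

Lemma cocoercive_lipschitz (sigma : R) (f : X -> X) : cocoercive ip sigma f ->
  forall x y, sigma * `|f x - f y| <= `|x - y|.
Proof.
move=> [s0 fs] x y.
have [->|n0] := eqVneq (f x - f y) 0; first by rewrite normr0 mulr0.
rewrite -(@ler_pM2r _ `|f x - f y|) ?normr_gt0// -mulrA -expr2.
apply: le_trans (fs x y) _; apply: le_trans (ler_norm _) _.
exact: ip_le_norm.
Qed.

(** Reduces vector identities to scalar ones, which [ring] and [field] settle once [ip] is
    expanded. *)
Lemma ip_ext x y : (forall z, ip x z = ip y z) -> x = y.
Proof.
move=> h; apply/subr0_eq/eqP.
rewrite -normr_eq0 -sqrf_eq0 -(ip_norm ip_inner).
by rewrite {1}(ipDl ip_inner) (ipNl ip_inner) h subrr.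
Qed.

End BoundedSequences.

(** * One step of the three-operator iteration *)

Section DavisYin.
Variables (R : realType) (X : completeNormedModType R) (ip : X -> X -> R).
Variables (A B : op X) (C jA jB : X -> X) (alpha sigma eta gamma : R).
Hypothesis ip_inner : inner_product ip.
Let ipE := (ipE ip_inner).
Let ipC := (ipC ip_inner).
Let ip_norm := (ip_norm ip_inner).

Let kappa := 1 + 2 * gamma * alpha.
Let delta := gamma / kappa.
Let lambda := 1 + delta / gamma.
Let eta_s := 2 + 2 * gamma * alpha - gamma / (2 * sigma).

(** [dy_shadow] is the operator S and [dy_map] is T, with the resolvents given as functions [jA] and
    [jB]; [dy_gap] is the residual of [dy_map] divided by [eta]. *)
Definition dy_shadow x := (1 - lambda) *: x + lambda *: jA x - delta *: C (jA x).
Definition dy_map x := x - eta *: jA x + eta *: jB (dy_shadow x).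
Definition dy_gap x := jA x - jB (dy_shadow x).

Hypothesis A_mono : alpha_monotone ip alpha A.
Hypothesis B_mono : alpha_monotone ip (- alpha) B.
Hypothesis C_coco : cocoercive ip sigma C.
Hypothesis eta0 : 0 < eta.
Hypothesis gamma0 : 0 < gamma.
Hypothesis kappa0 : 0 < kappa.
Hypothesis jA_mem : forall z, A (jA z) (gamma^-1 *: (z - jA z)).
Hypothesis jB_mem : forall z, B (jB z) (delta^-1 *: (z - jB z)).

Let sigma0 : 0 < sigma. Proof. by case: C_coco. Qed.
Let kappa_neq0 : kappa != 0. Proof. by rewrite gt_eqF. Qed.
Let gamma_neq0 : gamma != 0. Proof. by rewrite gt_eqF. Qed.
Let eta_neq0 : eta != 0. Proof. by rewrite gt_eqF. Qed.
Let sigma_neq0 : sigma != 0. Proof. by rewrite gt_eqF. Qed.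
Let delta0 : 0 < delta. Proof. by rewrite divr_gt0. Qed.
Let ga0 : 0 < 1 + gamma * alpha. Proof. by move: kappa0; rewrite /kappa; lra. Qed.
Let da0 : 0 < 1 + delta * - alpha.
Proof.
rewrite (_ : 1 + _ = (1 + gamma * alpha) / kappa) ?divr_gt0//.
by rewrite /delta; move: kappa_neq0; rewrite /kappa => ?; field.
Qed.

Lemma dy_mapE x : dy_map x = x - eta *: dy_gap x.
Proof. by rewrite /dy_map /dy_gap scalerBr opprB addrA addrAC. Qed.

(** The choice of [lambda] makes the element [gamma^-1 *: (x - jA x)] of [A] reappear here with
    opposite sign. *)
Lemma dy_B_mem x : B (jB (dy_shadow x))
  ((kappa / gamma) *: dy_gap x - gamma^-1 *: (x - jA x) - C (jA x)).
Proof.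
have := jB_mem (dy_shadow x).
suff -> : delta^-1 *: (dy_shadow x - jB (dy_shadow x)) =
  (kappa / gamma) *: dy_gap x - gamma^-1 *: (x - jA x) - C (jA x) by [].
rewrite /dy_gap; set b := jB _.
apply: (ip_ext ip_inner) => z; rewrite /dy_shadow /lambda /delta !ipE.
by field; rewrite kappa_neq0 gamma_neq0.
Qed.

(** Here [x], [a], [b], [c] stand for differences at two points. The value
    [kappa = 1 + 2 * gamma * alpha] is what makes the quadratic terms in [a] and [b] sum to
    [(1 + gamma * alpha) |a - b|^2]; splitting off [gamma / (4 * sigma)] of it completes the square
    with [c]. *)
Lemma dy_three_operator (x a b c : X) :
  alpha * `|a| ^+ 2 <= ip a (gamma^-1 *: (x - a)) ->
  - alpha * `|b| ^+ 2 <=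
    ip b ((kappa / gamma) *: (a - b) - gamma^-1 *: (x - a) - c) ->
  sigma * `|c| ^+ 2 <= ip a c ->
  eta_s / 2 * `|a - b| ^+ 2 + gamma / (4 * sigma) * `|a - b - (2 * sigma) *: c| ^+ 2
    <= ip (a - b) x.
Proof.
rewrite -!ip_norm => h1 h2 h3.
have g1 := ler_wpM2l (ltW gamma0) h1.
have g2 := ler_wpM2l (ltW gamma0) h2.
have g3 := ler_wpM2l (ltW gamma0) h3.
have e1 : gamma * ip a (gamma^-1 *: (x - a)) = ip a x - ip a a.
  by rewrite !ipE; field.
have e2 : gamma * ip b ((kappa / gamma) *: (a - b) - gamma^-1 *: (x - a) - c) =
    kappa * (ip a b - ip b b) - (ip b x - ip a b) - gamma * ip b c.
  by rewrite !ipE (ipC b a); field.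
have e3 : eta_s / 2 * ip (a - b) (a - b)
    + gamma / (4 * sigma) * ip (a - b - (2 * sigma) *: c) (a - b - (2 * sigma) *: c) =
    (1 + gamma * alpha) * ip (a - b) (a - b)
    + gamma * (sigma * ip c c) - gamma * (ip a c - ip b c).
  by rewrite /eta_s !ipE (ipC b a) (ipC c a) (ipC c b); field.
move: g1 g2 g3; rewrite e3 e1 e2 !ipE (ipC b a) /kappa; lra.
Qed.

(** Expand [|x - eta d|^2] and bound its cross term by [2 * eta] times the hypothesis. *)
Lemma dy_relax (x d c : X) :
  eta_s / 2 * `|d| ^+ 2 + gamma / (4 * sigma) * `|d - (2 * sigma) *: c| ^+ 2 <= ip d x ->
  `|x - eta *: d| ^+ 2 <= `|x| ^+ 2 - (eta_s / eta - 1) * `|eta *: d| ^+ 2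
    - gamma / (2 * eta * sigma) * `|eta *: d - (2 * eta * sigma) *: c| ^+ 2.
Proof.
have -> : (2 * eta * sigma) *: c = eta *: ((2 * sigma) *: c).
  by rewrite scalerA; congr (_ *: _); ring.
rewrite -scalerBr; set e := d - _.
rewrite -!ip_norm => /(ler_wpM2l (ltW eta0)) h.
rewrite -subr_ge0 [leRHS](_ : _ = 2 * (eta * ip d x - eta *
  (eta_s / 2 * ip d d + gamma / (4 * sigma) * ip e e))); last first.
  by rewrite !ipE (ipC x d); field; rewrite eta_neq0 sigma_neq0.
by rewrite mulr_ge0// subr_ge0.
Qed.

Lemma dy_gap_le x y :
  eta_s / 2 * `|dy_gap x - dy_gap y| ^+ 2
  + gamma / (4 * sigma) * `|dy_gap x - dy_gap y - (2 * sigma) *: (C (jA x) - C (jA y))| ^+ 2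
  <= ip (dy_gap x - dy_gap y) (x - y).
Proof.
have := @dy_three_operator (x - y) (jA x - jA y)
  (jB (dy_shadow x) - jB (dy_shadow y)) (C (jA x) - C (jA y)).
have -> : jA x - jA y - (jB (dy_shadow x) - jB (dy_shadow y)) = dy_gap x - dy_gap y.
  by apply: (ip_ext ip_inner) => z; rewrite /dy_gap !ipE; ring.
apply.
- apply: le_trans (A_mono (jA_mem x) (jA_mem y)) _.
  rewrite le_eqVlt; apply/orP; left; apply/eqP; congr (ip _ _).
  by apply: (ip_ext ip_inner) => z; rewrite !ipE; ring.
- apply: le_trans (B_mono (dy_B_mem x) (dy_B_mem y)) _.
  rewrite le_eqVlt; apply/orP; left; apply/eqP; congr (ip _ _).
  by apply: (ip_ext ip_inner) => z; rewrite !ipE; ring.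
- by case: C_coco => _; exact.
Qed.

Lemma dy_map_le x y :
  `|dy_map x - dy_map y| ^+ 2 <= `|x - y| ^+ 2
    - (eta_s / eta - 1) * `|(x - dy_map x) - (y - dy_map y)| ^+ 2
    - gamma / (2 * eta * sigma) * `|(x - dy_map x) - (y - dy_map y)
        - (2 * eta * sigma) *: (C (jA x) - C (jA y))| ^+ 2.
Proof.
have := dy_relax (dy_gap_le x y).
have -> : x - y - eta *: (dy_gap x - dy_gap y) = dy_map x - dy_map y.
  by apply: (ip_ext ip_inner) => z; rewrite !dy_mapE !ipE; ring.
have -> // : eta *: (dy_gap x - dy_gap y) = x - dy_map x - (y - dy_map y).
by apply: (ip_ext ip_inner) => z; rewrite !dy_mapE !ipE; ring.
Qed.

(** The nonexpansive operator is the same iteration with relaxation parameter [eta_s]. *)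
Lemma dy_map_conical : 0 < eta_s ->
  conically_averaged (eta / eta_s) (opfun dy_map).
Proof.
move=> es0; split; first exact: divr_gt0.
exists (fun x => x - eta_s *: dy_gap x); split; last first.
  move=> x; rewrite /opfun; congr [set _]; apply: (ip_ext ip_inner) => z.
  rewrite dy_mapE !ipE.
  by field; rewrite gt_eqF.
move=> x y; rewrite -ler_sqr ?nnegrE// -!ip_norm.
have := dy_gap_le x y; set d := dy_gap x - dy_gap y => h.
have -> : x - eta_s *: dy_gap x - (y - eta_s *: dy_gap y) = x - y - eta_s *: d.
  by apply: (ip_ext ip_inner) => z; rewrite /d !ipE; ring.
have : eta_s / 2 * `|d| ^+ 2 <= ip d (x - y).
  apply: le_trans h; rewrite lerDl mulr_ge0 ?sqr_ge0// divr_ge0 ?ltW//.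
  by rewrite mulr_gt0.
move=> /(ler_wpM2l (ltW es0)).
by move: (x - y) d {h} => v d; rewrite -ip_norm !ipE (ipC v d); lra.
Qed.

Lemma jA_unique x z : A x (gamma^-1 *: (z - x)) -> x = jA z.
Proof. by move=> Ax; exact: (resolvent_unique ip_inner A_mono gamma0 ga0 Ax). Qed.

Lemma jB_unique x z : B x (delta^-1 *: (z - x)) -> x = jB z.
Proof. by move=> Bx; exact: (resolvent_unique ip_inner B_mono delta0 da0 Bx). Qed.

Let Z := zer (opadd (opadd A B) (opfun C)).

Lemma dy_fixP x : dy_map x = x <-> dy_gap x = 0.
Proof.
rewrite dy_mapE; split=> [/eqP|->]; last by rewrite scaler0 subr0.
by rewrite -subr_eq0 addrAC subrr add0r oppr_eq0 scaler_eq0 (negbTE eta_neq0) => /eqP.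
Qed.

Lemma dy_fix_zer x : dy_map x = x -> Z (jA x).
Proof.
move=> /dy_fixP gap0.
have := dy_B_mem x; rewrite gap0 scaler0 sub0r.
move: gap0 => /subr0_eq <- Bx.
exists (- C (jA x)), (C (jA x)); split.
  exists (gamma^-1 *: (x - jA x)), (- (gamma^-1 *: (x - jA x)) - C (jA x)).
  by split; [exact: jA_mem|split=> //; rewrite addrA subrr add0r].
by rewrite /opfun /= addNr.
Qed.

Lemma dy_zer_fix p : Z p -> exists2 x, dy_map x = x & jA x = p.
Proof.
move=> [_ [_ [[u [v [Au [Bv ->]]]] [-> uvC]]]].
have v_def : v = - u - C p.
  by apply/eqP; rewrite eq_sym subr_eq -subr_eq0 -opprD oppr_eq0 addrA -uvC.
(* The fixed point is [p + gamma u]: its image under [jA] is [p], and its image under S is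
   [p + delta v], which [jB] sends to [p]. *)
have jp : jA (p + gamma *: u) = p.
  by apply/esym/jA_unique; rewrite addrAC subrr add0r scalerA mulVf// scale1r.
exists (p + gamma *: u) => //; apply/dy_fixP; rewrite /dy_gap jp.
apply/eqP; rewrite subr_eq0; apply/eqP/jB_unique.
suff -> : delta^-1 *: (dy_shadow (p + gamma *: u) - p) = v by [].
rewrite v_def; apply: (ip_ext ip_inner) => z; rewrite /dy_shadow jp.
by rewrite /lambda /delta !ipE; field; rewrite kappa_neq0 gamma_neq0.
Qed.

Lemma jA_lipschitz x y : (1 + gamma * alpha) * `|jA x - jA y| <= `|x - y|.
Proof.
have [->|n0] := eqVneq (jA x - jA y) 0; first by rewrite normr0 mulr0.
rewrite -(@ler_pM2r _ `|jA x - jA y|) ?normr_gt0// -mulrA -expr2.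
have := ler_wpM2l (ltW gamma0) (A_mono (jA_mem x) (jA_mem y)).
rewrite -ip_norm => h.
apply: le_trans (_ : _ <= ip (x - y) (jA x - jA y)) _; last first.
  by apply: le_trans (ler_norm _) _; exact: ip_le_norm.
have e : gamma * ip (jA x - jA y) (gamma^-1 *: (x - jA x) - gamma^-1 *: (y - jA y)) =
    ip (jA x - jA y) (x - y) - ip (jA x - jA y) (jA x - jA y).
  by rewrite !ipE; field.
by move: h; rewrite e (ipC (x - y)); lra.
Qed.

(** * Convergence of the iterates and their shadows *)

Section Iteration.
Hypothesis eta_lt : eta < eta_s.
Variable xs : nat -> X.
Hypothesis xsS : forall n, xs n.+1 = dy_map (xs n).

Let relax0 : 0 < eta_s / eta - 1.
Proof. by rewrite subr_gt0 ltr_pdivlMr// mul1r. Qed.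

Let weight0 : 0 < gamma / (2 * eta * sigma).
Proof. by rewrite divr_gt0// !mulr_gt0. Qed.

Lemma dy_map_nonexpansive : nonexpansive dy_map.
Proof.
move=> x y; rewrite -ler_sqr ?nnegrE//; apply: le_trans (dy_map_le x y) _.
by rewrite -addrA -opprD gerBl addr_ge0// mulr_ge0 ?sqr_ge0// ltW.
Qed.

Lemma dy_fejer y n : dy_map y = y -> `|xs n.+1 - y| ^+ 2 <= `|xs n - y| ^+ 2
  - ((eta_s / eta - 1) * `|xs n - xs n.+1| ^+ 2 + gamma / (2 * eta * sigma)
    * `|xs n - xs n.+1 - (2 * eta * sigma) *: (C (jA (xs n)) - C (jA y))| ^+ 2).
Proof.
move=> Ty; have := dy_map_le (xs n) y.
by rewrite -xsS Ty subrr subr0 opprD addrA.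
Qed.

(** Squared steps are summable by the Fejer estimate and nonincreasing by nonexpansiveness, so [n]
    times the squared step tends to 0. *)
Lemma dy_step_rate y : dy_map y = y ->
  Num.sqrt n%:R * `|xs n - xs n.+1| @[n --> \oo] --> (0 : R).
Proof.
move=> Ty; pose k := eta_s / eta - 1.
have h : n%:R * (k * `|xs n - xs n.+1| ^+ 2) @[n --> \oo] --> (0 : R).
  apply: (@cvg_natM_of_descent _ (fun n => k * `|xs n - xs n.+1| ^+ 2)
    (fun n => `|xs n - y| ^+ 2)) => n.
  - by rewrite mulr_ge0 ?sqr_ge0// ltW.
  - exact: sqr_ge0.
  - rewrite ler_wpM2l ?(ltW relax0)// ler_sqr ?nnegrE//.
    by rewrite {1}xsS (xsS n.+1); apply: dy_map_nonexpansive.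
  - apply: le_trans (dy_fejer _ Ty) _; rewrite opprD addrA gerBl.
    by rewrite mulr_ge0 ?sqr_ge0// ltW.
have h2 : (Num.sqrt n%:R * `|xs n - xs n.+1|) ^+ 2 @[n --> \oo] --> (0 : R).
  rewrite (_ : (fun n => _) = fun n => k^-1 * (n%:R * (k * `|xs n - xs n.+1| ^+ 2))).
    by rewrite -(mulr0 k^-1); exact: cvgMr.
  apply/funext => n; rewrite exprMn sqr_sqrtr ?ler0n// [in RHS](mulrCA n%:R) mulKf//.
  by rewrite gt_eqF.
have := cvg_comp _ _ h2 (@sqrt_continuous R 0); rewrite sqrtr0.
rewrite (_ : _ \o _ = fun n => Num.sqrt n%:R * `|xs n - xs n.+1|) //.
by apply/funext => n /=; rewrite sqrtr_sqr ger0_norm// mulr_ge0.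
Qed.

Lemma dy_step_cvg0 y : dy_map y = y -> xs n - xs n.+1 @[n --> \oo] --> (0 : X).
Proof.
move=> Ty; apply: cvg0_sqr_norm; pose k := eta_s / eta - 1.
have h : k * `|xs n - xs n.+1| ^+ 2 @[n --> \oo] --> (0 : R).
  apply: (@cvg_of_descent _ (fun n => k * `|xs n - xs n.+1| ^+ 2)
    (fun n => `|xs n - y| ^+ 2)) => n.
  - by rewrite mulr_ge0 ?sqr_ge0// ltW.
  - exact: sqr_ge0.
  - apply: le_trans (dy_fejer _ Ty) _; rewrite opprD addrA gerBl.
    by rewrite mulr_ge0 ?sqr_ge0// ltW.
rewrite (_ : (fun n => _) = fun n => k^-1 * (k * `|xs n - xs n.+1| ^+ 2)).
  by rewrite -(mulr0 k^-1); exact: cvgMr.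
by apply/funext => n; rewrite mulKf// gt_eqF.
Qed.

(** The last Fejer term also vanishes, and it differs from a multiple of the forward difference by a
    step tending to 0. The arbitrary fixed point [y] later shows that [C] is constant on the
    zeros. *)
Lemma dy_forward_cvg y : dy_map y = y -> C (jA (xs n)) @[n --> \oo] --> C (jA y).
Proof.
move=> Ty; pose k := gamma / (2 * eta * sigma); pose m := 2 * eta * sigma.
have m0 : m != 0 by rewrite gt_eqF// !mulr_gt0.
pose v n := xs n - xs n.+1 - m *: (C (jA (xs n)) - C (jA y)).
have h : k * `|v n| ^+ 2 @[n --> \oo] --> (0 : R).
  apply: (@cvg_of_descent _ (fun n => k * `|v n| ^+ 2)
    (fun n => `|xs n - y| ^+ 2)) => n.
  - by rewrite mulr_ge0 ?sqr_ge0// ltW.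
  - exact: sqr_ge0.
  - apply: le_trans (dy_fejer _ Ty) _; rewrite opprD addrA addrAC gerBl.
    by rewrite mulr_ge0 ?sqr_ge0// ltW.
have v0 : v n @[n --> \oo] --> (0 : X).
  apply: cvg0_sqr_norm.
  rewrite (_ : (fun n => _) = fun n => k^-1 * (k * `|v n| ^+ 2)).
    by rewrite -(mulr0 k^-1); exact: cvgMr.
  by apply/funext => n; rewrite mulKf// gt_eqF.
rewrite (_ : (fun n => _) =
    fun n => m^-1 *: (xs n - xs n.+1 - v n) + C (jA y)); last first.
  by apply/funext => n; rewrite /v subKr scalerA mulVf// scale1r subrK.
rewrite -[X in _ --> X]add0r; apply: cvgD; last exact: cvg_cst.
rewrite -(scaler0 _ m^-1); apply: cvgZr; rewrite -(subrr 0).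
by apply: cvgB => //; exact: dy_step_cvg0 Ty.
Qed.

Lemma dy_dist_cvg y : dy_map y = y -> cvgn (fun n => `|xs n - y| ^+ 2).
Proof.
move=> Ty; apply: nonincreasing_is_cvgn.
  apply/nonincreasing_seqP => n; apply: le_trans (dy_fejer _ Ty) _.
  by rewrite gerBl addr_ge0// mulr_ge0 ?sqr_ge0// ltW.
by exists 0 => _ [n _ <-]; exact: sqr_ge0.
Qed.

Lemma dy_bounded y : dy_map y = y -> norm_bounded xs.
Proof.
move=> Ty; exists (`|xs 0%N - y| + `|y|) => n.
rewrite -{1}(subrK y (xs n)); apply: le_trans (ler_normD _ _) _.
rewrite lerD2r; elim: n => // n; apply: le_trans.
by rewrite xsS -{1}Ty; exact: dy_map_nonexpansive.
Qed.

Lemma dy_gap_cvg0 y : dy_map y = y -> dy_gap (xs n) @[n --> \oo] --> (0 : X).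
Proof.
move=> Ty; rewrite (_ : (fun n => _) = fun n => eta^-1 *: (xs n - xs n.+1)).
  by rewrite -(scaler0 _ eta^-1); apply: cvgZr; exact: dy_step_cvg0 Ty.
apply/funext => n; rewrite xsS dy_mapE opprB addrC subrK.
by rewrite scalerA mulVf// scale1r.
Qed.

(* Summing the monotonicity inequalities of [A] and [B] along the iterates, the
   quadratic terms in [jA (xs n)] cancel because the moduli are opposite; what is
   left is affine and passes to the weak limit. Testing it at [jA x] and at the
   resolvent of [B] at [q - delta (u + C (jA x))], [u = (x - q) / gamma], forces
   [q = jA x]. *)
Lemma dy_shadow_limit U x q : ProperFilter U -> \oo `<=` U -> dy_map x = x ->
  weakly ip U xs x -> weakly ip U (fun n => jA (xs n)) q -> q = jA x.
Proof.
move=> UU ooU Tx xsx aq.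
set p := jA x; set c := C p.
pose us := gamma^-1 *: (x - p); pose u := gamma^-1 *: (x - q).
pose w0 := q - delta *: (u + c); set y := jB w0.
(* Thus [us] lies in [A p], [w] lies in [B y], and [q - y = delta (u + c + w)]. *)
pose w := delta^-1 *: (w0 - y).
pose a n := jA (xs n); pose g n := dy_gap (xs n).
pose un n := gamma^-1 *: (xs n - a n); pose cn n := C (a n).
have bE n : jB (dy_shadow (xs n)) = a n - g n by rewrite /g /dy_gap opprB addrC subrK.
pose L n := gamma^-1 * (ip (xs n) (y - p) - ip (a n) (y - p)) - ip (a n) us
  - ip (a n) (c + w) + 2 * alpha * ip (a n) (p - y)
  + (ip p us + ip y (c + w) + alpha * (ip y y - ip p p)).
pose K n := (kappa / gamma - 2 * alpha) *: (a n - y) + (alpha - kappa / gamma) *: g n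
  + (un n + (cn n + w)).
(* [L n] is affine in the weakly convergent quantities; the rest pairs bounded sequences with [g n]
   and [cn n - c], which tend strongly to 0. *)
have LE n : 0 <= L n + (ip (K n) (g n) - ip (a n - y) (cn n - c)).
  have h1 := A_mono (jA_mem (xs n)) (jA_mem x).
  have h2 := B_mono (dy_B_mem (xs n)) (jB_mem w0).
  move: h1 h2; rewrite bE -/(a n) -/p -/(g n) -/(un n) -/us -/(cn n) -/y -/w.
  rewrite -!ip_norm -subr_ge0 => h1; rewrite -subr_ge0 => h2.
  have := addr_ge0 h1 h2.
  congr (is_true (0 <= _)).
  rewrite /L /K /un; move: (xs n) (a n) (g n) (cn n) (us) (w) (y) (c) (p).
  move=> x1 a1 g1 c1 u1 w1 y1 c2 p1; rewrite !ipE.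
  rewrite ?(ipC p1 a1) ?(ipC y1 a1) ?(ipC g1 a1) ?(ipC x1 a1) ?(ipC y1 p1).
  rewrite ?(ipC x1 y1) ?(ipC x1 p1) ?(ipC x1 g1) ?(ipC c1 g1) ?(ipC c1 y1) ?(ipC c1 a1).
  rewrite ?(ipC w1 g1) ?(ipC g1 y1).
  by ring.
have ab : norm_bounded a.
  exact: (norm_bounded_lipschitz ga0 jA_lipschitz (dy_bounded Tx)).
have xsb : norm_bounded xs := dy_bounded Tx.
have gb : norm_bounded g.
  rewrite (_ : g = fun n => eta^-1 *: (xs n + - dy_map (xs n))).
    apply: norm_boundedZ; apply: norm_boundedD => //; apply: norm_boundedN.
    apply: (norm_bounded_lipschitz ltr01) xsb => x1 x2.
    by rewrite mul1r; exact: dy_map_nonexpansive.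
  apply/funext => n; rewrite dy_mapE subKr scalerA mulVf// scale1r.
  by [].
have cb : norm_bounded cn.
  exact: (norm_bounded_lipschitz sigma0 (cocoercive_lipschitz ip_inner C_coco) ab).
have g0 : g n @[n --> U] --> (0 : X).
  by apply: cvg_trans (dy_gap_cvg0 Tx); exact: cvg_app.
have c0 : cn n - c @[n --> U] --> (0 : X).
  rewrite -(subrr c); apply: cvgB; last exact: cvg_cst.
  by apply: cvg_trans (dy_forward_cvg Tx); exact: cvg_app.
pose l := gamma^-1 * (ip x (y - p) - ip q (y - p)) - ip q us
  - ip q (c + w) + 2 * alpha * ip q (p - y)
  + (ip p us + ip y (c + w) + alpha * (ip y y - ip p p)).
have Ll : L n + (ip (K n) (g n) - ip (a n - y) (cn n - c)) @[n --> U] --> l.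
  rewrite -[l]addr0; apply: cvgD.
    apply: cvgD; last exact: cvg_cst.
    apply: cvgD; last by apply: cvgMr; exact: aq.
    apply: cvgB; last exact: aq.
    apply: cvgB; last exact: aq.
    by apply: cvgMr; apply: cvgB; [exact: xsx|exact: aq].
  rewrite -[X in _ --> X](subrr (0 : R)); apply: cvgB.
    apply: (ip_bounded_cvg0 ip_inner) => //.
    apply: norm_boundedD.
      apply: norm_boundedD; apply: norm_boundedZ => //.
      by apply: norm_boundedD => //; exact: norm_bounded_cst.
    apply: norm_boundedD.
      apply: norm_boundedZ; apply: norm_boundedD => //; exact: norm_boundedN.
    by apply: norm_boundedD => //; exact: norm_bounded_cst.
  apply: (ip_bounded_cvg0 ip_inner) => //.
  by apply: norm_boundedD => //; exact: norm_bounded_cst.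
have l0 : 0 <= l.
  by apply: (cvgr_to_ge Ll); apply: filterE => n; exact: LE.
(* The choice of [y] turns the limit into minus a sum of two squares with positive weights, so
   [0 <= l] forces [q = p]. *)
have le : l = - ((1 + gamma * alpha) / gamma * ip (q - p) (q - p)
    + (1 + delta * - alpha) / delta * ip (q - y) (q - y)).
  have d0 : delta != 0 by rewrite gt_eqF.
  rewrite /l /us /w /w0 /u; move: (y) (p) (c) (delta) d0 => y1 p1 c1 d1 d0.
  rewrite !ipE ?(ipC y1 q) ?(ipC p1 q) ?(ipC y1 p1).
  rewrite ?(ipC x q) ?(ipC p1 x) ?(ipC y1 x) ?(ipC c1 q) ?(ipC c1 y1).
  by field; rewrite d0 gamma_neq0.
move: l0; rewrite le oppr_ge0.
have h1 : 0 < (1 + gamma * alpha) / gamma by rewrite divr_gt0.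
have h2 : 0 <= (1 + delta * - alpha) / delta * ip (q - y) (q - y).
  by rewrite mulr_ge0 ?(ip_ge0 ip_inner)// ltW// divr_gt0.
move=> h3.
have : (1 + gamma * alpha) / gamma * ip (q - p) (q - p) <= 0 by lra.
rewrite pmulr_rle0// ip_norm => h4.
apply/subr0_eq/eqP; rewrite -normr_eq0 -sqrf_eq0 eq_le h4.
by rewrite sqr_ge0.
Qed.

(** Opial applies to the fixed point set by Fejer monotonicity and demiclosedness. The second shadow
    differs from the first by the gap, which tends to 0. *)
Lemma dy_weak_convergence x0 : dy_map x0 = x0 -> exists x,
  [/\ dy_map x = x, weak_cvg ip xs x, weak_cvg ip (fun n => jA (xs n)) (jA x) &
      weak_cvg ip (fun n => jB (dy_shadow (xs n))) (jA x)].
Proof.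
move=> Tx0; have [M xsM] := dy_bounded Tx0.
have [|U p UU ooU xsp|x Tx xsx] :=
    @opial _ _ _ ip_inner [set x | dy_map x = x] xs M xsM.
- by move=> p; exact: dy_dist_cvg.
- apply: (demiclosed ip_inner _ dy_map_nonexpansive xsM xsp).
  have h : `|xs n - xs n.+1| @[n --> \oo] --> (0 : R).
    by rewrite -(normr0 X); apply: cvg_norm; exact: dy_step_cvg0 Tx0.
  under eq_fun do rewrite -xsS.
  by apply: cvg_trans h; exact: cvg_app.
have [N aN] : norm_bounded (fun n => jA (xs n)).
  exact: (norm_bounded_lipschitz ga0 jA_lipschitz (dy_bounded Tx)).
have ax : weak_cvg ip (fun n => jA (xs n)) (jA x).
  apply: (bounded_weak_cvg ip_inner aN) => U q UU ooU aq.
  apply: (@dy_shadow_limit U) => // z.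
  by apply: cvg_trans (xsx z); exact: cvg_app.
exists x; split=> // z.
rewrite (_ : (fun n => _) = fun n => ip (jA (xs n)) z - ip z (dy_gap (xs n))).
  rewrite -[ip (jA x) z]subr0; apply: cvgB; first exact: ax.
  apply: (ip_bounded_cvg0 ip_inner); last exact: dy_gap_cvg0 Tx.
  exact: norm_bounded_cst.
by apply/funext => n; rewrite (ipC z) /dy_gap !ipE opprB addrC subrK.
Qed.

End Iteration.
End DavisYin.

(** * Reduction of set-valued operator algebra to functions *)

Section SingleValuedOperators.
Variables (R : realType) (X : normedModType R).

Lemma opId_opfun : @opId R X = opfun id.
Proof. by []. Qed.

Lemma opadd_opfun (f g : X -> X) : opadd (opfun f) (opfun g) = opfun (fun x => f x + g x).
Proof.
apply/funext => x; apply/seteqP; split=> y /=.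
  by move=> [u [v [-> [-> ->]]]].
by move=> ->; exists (f x), (g x).
Qed.

Lemma opsub_opfun (f g : X -> X) : opsub (opfun f) (opfun g) = opfun (fun x => f x - g x).
Proof.
rewrite /opsub -(opadd_opfun f (fun x => - g x)); congr opadd.
apply/funext => x; apply/seteqP; split=> y /=.
  by move=> [u [-> ->]].
by move=> ->; exists (g x).
Qed.

Lemma opscale_opfun a (f : X -> X) : opscale a (opfun f) = opfun (fun x => a *: f x).
Proof.
apply/funext => x; apply/seteqP; split=> y /=.
  by move=> [u [-> ->]].
by move=> ->; exists (f x).
Qed.

Lemma opcomp_opfun (f g : X -> X) : opcomp (opfun f) (opfun g) = opfun (f \o g).
Proof.
apply/funext => x; apply/seteqP; split=> y /=.
  by move=> [u [-> ->]].
by move=> ->; exists (g x).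
Qed.

Lemma resolvent_scaleE (a : R) (A : op X) z x : a != 0 ->
  resolvent (opscale a A) z x <-> A x (a^-1 *: (z - x)).
Proof.
move=> a0; split.
  move=> [_ [_ [-> [[u [Au ->]] ->]]]].
  by rewrite addrAC subrr add0r scalerA mulVf// scale1r.
move=> Ax; exists x, (z - x); split=> //; split; last by rewrite addrC subrK.
by exists (a^-1 *: (z - x)); rewrite scalerA mulfV// scale1r.
Qed.

End SingleValuedOperators.

Lemma resolvent_opfun (R : realType) (X : completeNormedModType R) (ip : X -> X -> R)
    (A : op X) (a g : R) : inner_product ip -> max_alpha_monotone ip a A ->
  0 < g -> 0 < 1 + g * a ->
  exists2 j : X -> X, resolvent (opscale g A) = opfun j &
    forall z, A (j z) (g^-1 *: (z - j z)).
Proof.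
move=> ip_inner Am g0 ga0.
have /choice[j jP] := max_alpha_monotone_surj ip_inner Am g0 ga0.
exists j => //; apply/funext => z; apply/seteqP; split=> x.
  move=> /resolvent_scaleE Ax.
  apply: (resolvent_unique ip_inner Am.1 g0 ga0 _ (jP z)).
  by apply: Ax; rewrite gt_eqF.
by move=> ->; apply/resolvent_scaleE => //; rewrite gt_eqF.
Qed.

Unset Implicit Arguments.

Theorem theorem4p1 (R : realType) (X : completeNormedModType R)
    (ip : X -> X -> R) (A B : op X) (C : X -> X) (alpha beta sigma eta gamma : R) :
  inner_product ip ->
  max_alpha_monotone ip alpha A -> max_alpha_monotone ip beta B ->
  alpha + beta = 0 ->
  cocoercive ip sigma C ->
  0 < eta -> 0 < gamma ->
  0 < 1 + 2 * gamma * alpha ->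
  let eta_s := 2 + 2 * gamma * alpha - gamma / (2 * sigma) in
  0 < eta_s ->
  let delta := gamma / (1 + 2 * gamma * alpha) in
  let lambda := 1 + delta / gamma in
  let JA := resolvent (opscale gamma A) in
  let JB := resolvent (opscale delta B) in
  let Sop := opsub (opadd (opscale (1 - lambda) (@opId _ X)) (opscale lambda JA))
                 (opscale delta (opcomp (opfun C) JA)) in
  let T := opadd (opsub (@opId _ X) (opscale eta JA))
                 (opscale eta (opcomp JB Sop)) in
  let ZABC := zer (opadd (opadd A B) (opfun C)) in
  (* (i) *)
  single_valued_full_domain T /\
  (* (ii) *)
  (forall x y tx ty jx jy, T x tx -> T y ty -> JA x jx -> JA y jy ->
     `|tx - ty| ^+ 2 <= `|x - y| ^+ 2
       - (eta_s / eta - 1) * `|(x - tx) - (y - ty)| ^+ 2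
       - gamma / (2 * eta * sigma)
         * `|(x - tx) - (y - ty) - (2 * eta * sigma) *: (C jx - C jy)| ^+ 2) /\
  conically_averaged (eta / eta_s) T /\
  (* (iii) *)
  (ZABC !=set0 -> eta < eta_s ->
   forall xs : nat -> X, (forall n, T (xs n) (xs n.+1)) ->
     (Num.sqrt (n%:R) * `|xs n - xs n.+1| @[n --> \oo] --> (0 : R)) /\
     exists xstar p : X,
       Fix T xstar /\ weak_cvg ip xs xstar /\
       JA xstar p /\ opcomp JB Sop xstar p /\ ZABC p /\
       (forall j : nat -> X, (forall n, JA (xs n) (j n)) -> weak_cvg ip j p) /\
       (forall j : nat -> X, (forall n, opcomp JB Sop (xs n) (j n)) -> weak_cvg ip j p) /\
       (forall j : nat -> X, (forall n, JA (xs n) (j n)) ->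
          C (j n) @[n --> \oo] --> C p) /\
       C @` ZABC = [set C p]).
Proof.
move=> ip_inner Am Bm ab0 C_coco eta0 gamma0 kappa0 eta_s es0 delta lambda JA JB Sop T ZABC.
have beta_def : beta = - alpha by apply/eqP; rewrite -addr_eq0 addrC ab0.
subst beta.
have delta0 : 0 < delta by rewrite divr_gt0.
have ga0 : 0 < 1 + gamma * alpha by lra.
have da0 : 0 < 1 + delta * - alpha.
  rewrite (_ : 1 + _ = (1 + gamma * alpha) / (1 + 2 * gamma * alpha)) ?divr_gt0//.
  by rewrite /delta; field; rewrite gt_eqF.
have [jA JAE jA_mem] := resolvent_opfun ip_inner Am gamma0 ga0.
have [jB JBE jB_mem] := resolvent_opfun ip_inner Bm delta0 da0.
have SopE : Sop = opfun (dy_shadow C jA alpha gamma).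
  by rewrite /Sop /JA JAE opId_opfun opcomp_opfun !opscale_opfun opadd_opfun opsub_opfun.
pose t := dy_map C jA jB alpha eta gamma.
have TE : T = opfun t.
  rewrite /T SopE /JA /JB JAE JBE opcomp_opfun !opscale_opfun opId_opfun.
  by rewrite opsub_opfun opadd_opfun.
rewrite TE /JA JAE /JB JBE SopE opcomp_opfun.
split; first by move=> x; exists (t x); split=> // y ->.
split.
  move=> x y _ _ _ _ -> -> -> ->.
  exact: (dy_map_le ip_inner Am.1 Bm.1 C_coco eta0 gamma0 kappa0 jA_mem jB_mem).
split.
  exact: (dy_map_conical ip_inner Am.1 Bm.1 C_coco eta0 gamma0 kappa0 jA_mem jB_mem es0).
move=> [p0 Zp0] eta_lt xs xsS.
have zer_fix := dy_zer_fix ip_inner Am.1 Bm.1 eta0 gamma0 kappa0 jA_mem jB_mem.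
have [x0 Tx0 _] := zer_fix _ _ Zp0.
split.
  exact: (dy_step_rate ip_inner Am.1 Bm.1 C_coco eta0 gamma0 kappa0 jA_mem jB_mem eta_lt xsS Tx0).
have [x [Tx xsx ax bx]] := dy_weak_convergence ip_inner Am.1 Bm.1 C_coco eta0 gamma0
  kappa0 jA_mem jB_mem eta_lt xsS Tx0.
have C_cvg y : t y = y -> C (jA (xs n)) @[n --> \oo] --> C (jA y).
  exact: (dy_forward_cvg ip_inner Am.1 Bm.1 C_coco eta0 gamma0 kappa0 jA_mem jB_mem eta_lt xsS).
have Zx : ZABC (jA x) by exact: (dy_fix_zer ip_inner eta0 gamma0 kappa0 jA_mem jB_mem Tx).
exists x, (jA x); split; first by rewrite /Fix /= /opfun /= [RHS]Tx.
do 2![split=> //].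
split.
  by have /subr0_eq := (dy_fixP C jA jB alpha gamma eta0 x).1 Tx.
split=> //; split; first by move=> j jE; rewrite (_ : j = fun n => jA (xs n))//; exact/funext.
split.
  move=> j jE; rewrite (_ : j = fun n => jB (dy_shadow C jA alpha gamma (xs n)))//.
  exact/funext.
split; first by move=> j jE; rewrite (_ : j = fun n => jA (xs n)); [exact: C_cvg|exact/funext].
apply/seteqP; split=> [_ [p Zp <-]|_ ->]; last by exists (jA x).
(* Every zero is [jA y] for a fixed point [y], and the single sequence [C (jA (xs n))] converges to
   [C (jA y)] for each of them. *)
have [y Ty <-] := zer_fix _ _ Zp.
exact: (cvg_unique _ (C_cvg _ Ty) (C_cvg _ Tx)).
Qed.
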